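(* Let $q$ be a prime power, let $v=q^2+q+1$, and let $D\subseteq\mathbb{Z}/v\mathbb{Z}$ be a perfect difference set with $qD=D$. Let $\alpha$ be the bijection $j\mapsto j+D$ from the points $P=\mathbb{Z}/v\mathbb{Z}$ to the lines $L=\{j+D: j\in\mathbb{Z}/v\mathbb{Z}\}$ of the projective plane described by $D$. Let $f$ be the number of fixed points and $t=\frac13(|D|-f)$ the number of orbits of order $3$ of the action of multiplication by $q$ on $D$, and let $D'=\{d'_1,\dots,d'_{f+t}\}\subseteq D$ be a set of representatives of the orbits of this action. Then there are at least $2^t$ distinct triangle presentations compatible with $\alpha$ of the form $$\mathscr{T}=\bigcup_{i=1}^{f+t}\langle d'_i,\, m_id'_i,\, m_i^2d'_i\rangle ,\qquad m_i\in\{q,q^2\}\ \text{ for each } i,$$ where triangle presentations are written up to cyclic permutation of triples (that is, the displayed union stands for its closure under $(a,b,c)\mapsto(b,c,a)$).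
   Context: Perfect difference set: a subset $D\subseteq\mathbb{Z}/v\mathbb{Z}$, $v=q^2+q+1$, with $|D|=q+1$, such that every nonzero element of $\mathbb{Z}/v\mathbb{Z}$ occurs exactly once among the differences $d-d'$ with $d,d'\in D$. The projective plane described by $D$ has point set $\mathbb{Z}/v\mathbb{Z}$ and line set $\{j+D\}$, incidence being membership. Since $q^3\equiv 1 \pmod v$, the orbits of multiplication by $q$ on $D$ are $\{d,qd,q^2d\}$ and have order $1$ or $3$. For $d\in D$ and $m\in\{q,q^2\}$, $\langle d, md, m^2d\rangle=\{(j,\, j+d,\, j+d+md): j\in\mathbb{Z}/v\mathbb{Z}\}$. Triangle presentation: let $P$ and $L$ be the sets of points and lines of a projective plane and $\alpha:P\to L$ a bijection. A set $\mathscr{T}$ of triples $(a,b,c)\in P^3$ is a triangle presentation compatible with $\alpha$ if: (1) given $a,b\in P$, one has $(a,b,c)\in\mathscr{T}$ for some $c\in P$ if and only if $b$ and $\alpha(a)$ are incident; (2) $(a,b,c)\in\mathscr{T}$ implies $(b,c,a)\in\mathscr{T}$; (3) given $a,b\in P$, one has $(a,b,c)\in\mathscr{T}$ for at most one $c\in P$. Convention: a triangle presentation may be recorded by listing its triples only up to cyclic permutation. *)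

(* Defs.v *)
From mathcomp Require Import all_boot all_order all_algebra.
From mathcomp Require Import ring.

Set Implicit Arguments.
Unset Strict Implicit.
Unset Printing Implicit Defensive.

Import GRing.Theory.
Local Open Scope ring_scope.

Definition prime_power (q : nat) : Prop :=
  exists p k : nat, [/\ prime p, (0 < k)%N & q = (p ^ k)%N].

Definition projective_plane (P L : Type) (inc : P -> L -> bool) : Prop :=
  [/\ forall a b : P, a <> b -> exists! l : L, inc a l /\ inc b l,
      forall l m : L, l <> m -> exists! a : P, inc a l /\ inc a m
    & exists2 a : 'I_4 -> P, injective a &
        forall (i j k : 'I_4) (l : L), uniq [:: i; j; k] ->
          ~~ [&& inc (a i) l, inc (a j) l & inc (a k) l]].

(* The first two fields are the standing assumptions under which
   compatibility is defined. *)
Record triangle_presentation (P L : Type) (inc : P -> L -> bool)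
    (alpha : P -> L) (T : {pred P * P * P}) : Prop := TrianglePresentation {
  tp_plane : projective_plane inc;
  tp_bij : bijective alpha;
  tp_ex : forall a b : P, (exists c : P, (a, b, c) \in T) <-> inc b (alpha a);
  tp_rot : forall a b c : P, (a, b, c) \in T -> (b, c, a) \in T;
  tp_uniq : forall a b c c' : P,
    (a, b, c) \in T -> (a, b, c') \in T -> c = c'
}.

Definition rot3 (P : Type) (x : P * P * P) : P * P * P :=
  let: (a, b, c) := x in (b, c, a).

Definition cyclic_closure (P : finType) (T : {set P * P * P}) :
    {set P * P * P} :=
  T :|: [set rot3 x | x in T] :|: [set rot3 (rot3 x) | x in T].

Definition pds_mod (q : nat) : nat := (q ^ 2 + q + 1)%N.

(* The modulus is at least 2 as soon as q > 0, so that 'Z_(pds_mod q) is then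
   really Z/(q^2+q+1)Z. *)
Notation pds_point q := 'Z_(pds_mod q).

Section DifferenceSet.

Variables (q : nat) (D : {set pds_point q}).

Definition perfect_difference_set : Prop :=
  #|D| = q.+1 /\
  forall x : pds_point q, x != 0 ->
    #|[set p in setX D D | p.1 - p.2 == x]| = 1%N.

Definition translate (j : pds_point q) : {set pds_point q} :=
  [set j + d | d in D].

Definition pds_lines : {set {set pds_point q}} := [set translate j | j in setT].

Definition pds_line : Type := {l : {set pds_point q} | l \in pds_lines}.

Definition pds_inc (a : pds_point q) (l : pds_line) : bool := a \in sval l.

Definition pds_alpha (j : pds_point q) : pds_line :=
  exist _ (translate j) (imset_f translate (in_setT j)).

Definition mulq (x : pds_point q) : pds_point q := q%:R * x.

Definition mulq_stable : Prop := [set mulq d | d in D] = D.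

Definition mulq_orbits : {set {set pds_point q}} :=
  [set [set y in orbit mulq d] | d in D].

Definition nb_fixed : nat := #|[set d in D | mulq d == d]|.

Definition nb_orbits3 : nat := #|[set O in mulq_orbits | #|O| == 3]|.

(* The family written <d, m d, m^2 d>. *)
Definition bracket (d m : pds_point q) :
    {set pds_point q * pds_point q * pds_point q} :=
  [set (j, j + d, j + d + m * d) | j in setT].

End DifferenceSet.

Section OrbitCount.

Variables (q : nat) (D : {set pds_point q}).
Hypotheses (q_gt0 : (0 < q)%N) (qD : mulq_stable D).

Lemma mulq3 (x : pds_point q) : mulq (mulq (mulq x)) = x.
Proof.
have v_gt1 : (1 < pds_mod q)%N by rewrite /pds_mod addn1 ltnS addn_gt0 q_gt0 orbT.
have v0 : (pds_mod q)%:R = 0 :> pds_point q.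
  by apply: val_inj; rewrite /= val_Zp_nat // modnn.
have q3 : (q%:R : pds_point q) * q%:R * q%:R = 1.
  rewrite /pds_mod !natrD natrX in v0.
  apply/eqP; rewrite -subr_eq0 -[X in _ == X](mulr0 (q%:R - 1)) -v0.
  by apply/eqP; ring.
by rewrite /mulq !mulrA q3 mul1r.
Qed.

Lemma mulq_inj : injective (@mulq q).
Proof. exact: (can_inj (g := fun x => mulq (mulq x)) mulq3). Qed.

Lemma mem_mulq x : x \in D -> mulq x \in D.
Proof. by move=> Dx; rewrite -qD imset_f. Qed.

Lemma orbit_mulqE x :
  [set y in orbit (@mulq q) x] = [set x; mulq x; mulq (mulq x)].
Proof.
apply/setP=> y; rewrite !inE -fconnect_orbit -orbA; apply/idP/idP; last first.
  case/or3P=> /eqP ->; rewrite ?connect0 ?fconnect1 //.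
  exact: (fconnect_iter _ 2).
move/iter_findex=> <-; elim: (findex _ x y) => [|n IHn]; first by rewrite eqxx.
by rewrite iterS; case/or3P: IHn => /eqP -> /=; rewrite ?mulq3 !eqxx ?orbT.
Qed.

Lemma mulq_orbits_partition : partition (mulq_orbits D) D.
Proof.
have eqR : {in D & &, equivalence_rel (fconnect (@mulq q))}.
  move=> x y z _ _ _; split=> [|xy]; first exact: connect0.
  exact: (same_connect (fconnect_sym mulq_inj) xy).
suff <- : equivalence_partition (fconnect (@mulq q)) D = mulq_orbits D.
  exact: equivalence_partitionP.
apply: eq_in_imset => x Dx; apply/setP=> y; rewrite inE [RHS]inE -fconnect_orbit.
apply/andb_idl; rewrite fconnect_orbit => xy.
have: y \in [set y in orbit (@mulq q) x] by rewrite inE.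
by rewrite orbit_mulqE !inE -orbA => /or3P[] /eqP ->; do ?apply: mem_mulq.
Qed.

Lemma card_orbit_mulq x :
  #|[set y in orbit (@mulq q) x]| = (if mulq x == x then 1 else 3)%N.
Proof.
rewrite orbit_mulqE; case: eqP => [xE | /eqP nx].
  by rewrite !xE !setUid cards1.
have n1 : mulq x != mulq (mulq x) by rewrite (inj_eq mulq_inj) eq_sym.
have n2 : x != mulq (mulq x) by rewrite -{1}[x]mulq3 (inj_eq mulq_inj) eq_sym.
by rewrite setUC cardsU1 cards2 !inE negb_or ![_ == x]eq_sym n2 eq_sym n1 eq_sym nx.
Qed.

(* Hence nb_orbits3 D = (#|D| - f) / 3, the other orbits being fixed points. *)
Lemma nb_orbits3E : (nb_fixed D + 3 * nb_orbits3 D)%N = #|D|.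
Proof.
rewrite (card_partition mulq_orbits_partition).
rewrite (bigID [pred O : {set _} | #|O| == 3]) /= addnC; congr addn.
  rewrite (eq_bigr (fun=> 3)); last by move=> O /andP[_ /eqP].
  by rewrite sum_nat_const mulnC; congr (_ * _)%N; apply: eq_card => O; rewrite !inE.
rewrite (eq_bigr (fun=> 1%N)); last first.
  move=> _ /andP[/imsetP[x _ ->]]; rewrite card_orbit_mulq.
  by case: ifP.
rewrite sum1_card /nb_fixed -(card_imset _ (@set1_inj _)); apply: eq_card => O.
rewrite [RHS]unfold_in /=; apply/imsetP/andP => [[x] | [/imsetP[x Dx ->]]].
  rewrite inE => /andP[Dx xE] ->.
  have oE : [set x] = [set y in orbit (@mulq q) x].
    by rewrite orbit_mulqE !(eqP xE) !setUid.
  by rewrite oE card_orbit_mulq xE; split=> //; apply: imset_f.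
rewrite card_orbit_mulq; case: ifP => // xE _; exists x; rewrite ?inE ?Dx //.
by rewrite orbit_mulqE !(eqP xE) !setUid.
Qed.

End OrbitCount.

(* Main.v *)
(* A choice of [m_i] in {q, q^2} for each orbit amounts to a function [mu] on [D],
   constant on orbits, and the closure of the union of brackets is the set of
   (a, a + e, a + e + mu(e) e) with [e] in [D]: indeed 1 + m + m^2 = 0 for both
   values of [m], so rotating a triple of <d, m d, m^2 d> replaces [d] by [m d].
   Two such functions give different sets as soon as they differ on an orbit of
   size 3, where q e <> q^2 e. *)
Require Import Defs.
From mathcomp Require Import all_boot all_order all_algebra.
From mathcomp Require Import ring.

Set Implicit Arguments.
Unset Strict Implicit.
Unset Printing Implicit Defensive.

(* Restores [mulq], which mathcomp.algebra.rat shadows. *)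
Import Defs.

Import GRing.Theory.
Local Open Scope ring_scope.

Lemma prime_power_gt1 q : prime_power q -> (1 < q)%N.
Proof.
case=> p [k [p_pr k_gt0 ->]].
by rewrite -(exp1n k) ltn_exp2r ?prime_gt1.
Qed.

(** * The translates of a perfect difference set as lines of a projective plane *)

Section Plane.

Variables (q : nat) (D : {set pds_point q}).
Hypotheses (q_gt1 : (1 < q)%N) (pdsD : perfect_difference_set D).

Lemma mem_translate (a j : pds_point q) : (a \in translate D j) = (a - j \in D).
Proof.
apply/imsetP/idP => [[d Dd ->]|Daj]; first by rewrite addrC addKr.
by exists (a - j) => //; rewrite addrC subrK.
Qed.

Lemma pds_diff_ex (x : pds_point q) : x != 0 ->
  exists d e, [/\ d \in D, e \in D & d - e = x].
Proof.
move=> /(proj2 pdsD)/eqP/cards1P[[d e] /setP/(_ (d, e))].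
by rewrite !inE eqxx -andbA => /and3P[Dd De /eqP]; exists d, e.
Qed.

Lemma pds_diff_inj (d1 e1 d2 e2 : pds_point q) :
  d1 \in D -> e1 \in D -> d2 \in D -> e2 \in D ->
  d1 != e1 -> d1 - e1 = d2 - e2 -> d1 = d2 /\ e1 = e2.
Proof.
rewrite -subr_eq0 => D1 E1 D2 E2 /(proj2 pdsD)/eqP/cards1P[p /setP eqp] eq12.
have := eqp (d1, e1); rewrite !inE /= D1 E1 eqxx => /esym/eqP p1.
have := eqp (d2, e2); rewrite !inE /= D2 E2 eq12 eqxx -p1 => /esym/eqP.
by case.
Qed.

(** A common point [a] gives [a - j] and [a - k] in [D] with nonzero difference [k - j]; only one
    pair in [D] has this difference. *)
Lemma translates_meet_unique (j k a b : pds_point q) : j != k ->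
  a \in translate D j -> a \in translate D k ->
  b \in translate D j -> b \in translate D k -> a = b.
Proof.
rewrite !mem_translate => jk aj ak bj bk.
have [||eq_ab _] // := pds_diff_inj aj ak bj bk.
- by rewrite (inj_eq (addrI a)) eqr_opp.
- by ring.
exact: (addIr _ eq_ab).
Qed.

Lemma translates_meet (j k : pds_point q) : j != k ->
  exists a, a \in translate D j /\ a \in translate D k.
Proof.
move=> jk; have kj0 : k - j != 0 by rewrite subr_eq0 eq_sym.
have [d [e [Dd De de]]] := pds_diff_ex kj0.
exists (j + d); rewrite !mem_translate.
have -> : j + d - j = d by ring.
by have -> : j + d - k = e by rewrite -[k](subrK j) -de; ring.
Qed.

Lemma card_translate (j : pds_point q) : #|translate D j| = q.+1.
Proof. by rewrite card_imset ?(proj1 pdsD) //; apply: addrI. Qed.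

(** Distinct indices allow at most one common point, while a translate has [q + 1 > 1] points. *)
Lemma translate_inj : injective (translate D).
Proof.
move=> j k ejk; apply/eqP/negPn/negP=> jk.
have : (1 < #|translate D j|)%N by rewrite card_translate ltnS ltnW.
case/card_gt1P=> a [b [aj bj /eqP]]; apply.
by apply: (translates_meet_unique jk) => //; rewrite -ejk.
Qed.

Lemma pds_alpha_bij : bijective (pds_alpha D).
Proof.
have surj (l : pds_line D) : exists j, sval l == translate D j.
  by case: l => l /= /imsetP[j _ ->]; exists j.
exists (fun l => xchoose (surj l)) => [j|l].
  by apply: translate_inj; apply/esym/eqP; apply: (xchooseP (surj (pds_alpha D j))).
by apply: val_inj; apply/esym/eqP; apply: (xchooseP (surj l)).
Qed.

Lemma pds_lineP (l : pds_line D) : exists j, l = pds_alpha D j.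
Proof. by case: pds_alpha_bij => g _ gK; exists (g l); rewrite gK. Qed.

Lemma translates_diff_gt1 (j k : pds_point q) : j != k ->
  (1 < #|translate D j :\: translate D k|)%N.
Proof.
move=> jk; have [a [aj ak]] := translates_meet jk.
rewrite cardsD card_translate.
suff -> : translate D j :&: translate D k = [set a] by rewrite cards1 subn1.
apply/setP=> b; rewrite !inE; apply/andP/eqP => [[bj bk]|->] //.
exact: (translates_meet_unique jk).
Qed.

Lemma pds_plane : projective_plane (@pds_inc q D).
Proof.
split.
- move=> a b /eqP; rewrite -subr_eq0 => ab0.
  have [d [e [Dd De de]]] := pds_diff_ex ab0.
  (* From [a - b = d - e] follows [a - d = b - e], the index of the joining line. *)
  exists (pds_alpha D (a - d)); split.
    rewrite /pds_inc /= !mem_translate.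
    have -> : a - (a - d) = d by ring.
    by have -> : b - (a - d) = e by rewrite -[a](subrK b) -de; ring.
  move=> l; have [j ->] := pds_lineP l; rewrite /pds_inc /= !mem_translate.
  move=> [aj bj]; congr pds_alpha.
  have [||-> _] // := pds_diff_inj Dd De aj bj.
  - by rewrite -subr_eq0 de.
  - by rewrite de; ring.
  - by ring.
- move=> l m; have [j ->] := pds_lineP l; have [k ->] := pds_lineP m => jk.
  have {}jk : j != k by apply/eqP=> ejk; apply: jk; rewrite ejk.
  have [a [aj ak]] := translates_meet jk; exists a; split=> // b [bj bk].
  exact: (translates_meet_unique jk).
have nz1 : (0 : pds_point q) != 1 by rewrite eq_sym oner_neq0.
have /card_gt1P[a [b []]] := translates_diff_gt1 nz1.
rewrite eq_sym in nz1; have /card_gt1P[c [d []]] := translates_diff_gt1 nz1.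
rewrite !in_setD => /andP[c0 c1] /andP[d0 d1] cd /andP[a1 a0] /andP[b1 b0] ab.
have sep x y z j (k : pds_point q) : x != y -> x \in translate D j ->
    y \in translate D j -> z \notin translate D j ->
    ~~ [&& x \in translate D k, y \in translate D k & z \in translate D k].
  move=> xy xj yj zj; apply/and3P=> -[xk yk zk].
  have jk : j != k by apply: contraNneq zj => ->.
  by move/eqP: xy; apply; apply: (translates_meet_unique jk).
have diff x y (A : {set pds_point q}) : x \in A -> y \notin A -> x != y.
  by move=> xA; apply: contraNneq => <-.
have s_uniq : uniq [:: a; b; c; d].
  rewrite /= !inE !negb_or ab cd (diff _ _ _ a0 c0) (diff _ _ _ a0 d0).
  by rewrite (diff _ _ _ b0 c0) (diff _ _ _ b0 d0).
exists (fun i : 'I_4 => [:: a; b; c; d]`_i).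
  by move=> i j /eqP; rewrite nth_uniq // => /eqP /val_inj.
move=> i j k l; have [n ->] := pds_lineP l; rewrite /pds_inc /=.
have := sep a b c _ n ab a0 b0 c0; have := sep a b d _ n ab a0 b0 d0.
have := sep c d a _ n cd c1 d1 a1; have := sep c d b _ n cd c1 d1 b1.
case: i j k => [[|[|[|[|//]]]] ?] [[|[|[|[|//]]]] ?] [[|[|[|[|//]]]] ?] //=;
by case: (a \in _); case: (b \in _); case: (c \in _); case: (d \in _).
Qed.

End Plane.

(** * Triangle presentations from a choice of multiplier on each orbit *)

Section Choices.

Variables (q : nat) (D : {set pds_point q}).
Hypotheses (q_gt0 : (0 < q)%N) (qD : mulq_stable D).

Definition mulq_orbit (e : pds_point q) : {set pds_point q} :=
  [set y in orbit (@mulq q) e].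

(** A choice is encoded by the set [A] of orbits that receive [q^2], so that choices are counted by
    a powerset. *)
Definition choice_mult (A : {set {set pds_point q}}) (e : pds_point q) :
    pds_point q :=
  if mulq_orbit e \in A then q%:R ^+ 2 else q%:R.

Definition choice_triples (A : {set {set pds_point q}}) :
    {set pds_point q * pds_point q * pds_point q} :=
  [set x | (x.1.2 - x.1.1 \in D) &&
     (x.2 == x.1.2 + choice_mult A (x.1.2 - x.1.1) * (x.1.2 - x.1.1))].

Lemma choice_triplesP A (a b c : pds_point q) :
  reflect (b - a \in D /\ c = b + choice_mult A (b - a) * (b - a))
          ((a, b, c) \in choice_triples A).
Proof. by rewrite inE /=; apply: (iffP andP) => -[Dba /eqP]. Qed.

Lemma mulq_orbit_mulq e : mulq_orbit (mulq e) = mulq_orbit e.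
Proof.
apply/setP=> x; rewrite /mulq_orbit !orbit_mulqE // !inE mulq3 //.
by case: (x == e); case: (x == mulq e); case: (x == mulq (mulq e)).
Qed.

Lemma mem_mulq_orbit e : e \in mulq_orbit e.
Proof. by rewrite /mulq_orbit orbit_mulqE // !inE eqxx. Qed.

Lemma choice_mult_eqP A e :
  choice_mult A e * e = mulq e \/ choice_mult A e * e = mulq (mulq e).
Proof. by rewrite /choice_mult /mulq; case: ifP; [right|left]; ring. Qed.

Lemma choice_mult_orbit A e : mulq_orbit (choice_mult A e * e) = mulq_orbit e.
Proof. by case: (choice_mult_eqP A e) => ->; rewrite !mulq_orbit_mulq. Qed.

Lemma choice_multK A e : choice_mult A (choice_mult A e * e) = choice_mult A e.
Proof. by rewrite /choice_mult choice_mult_orbit. Qed.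

Lemma mem_choice_mult A e : e \in D -> choice_mult A e * e \in D.
Proof. by move=> De; case: (choice_mult_eqP A e) => ->; do ?apply: mem_mulq. Qed.

(** For [m = q] the sum is the modulus; for [m = q^2] it factors as [(1 - q + q^2)(1 + q + q^2)]. *)
Lemma choice_mult_sum0 A e :
  1 + choice_mult A e + choice_mult A e ^+ 2 = 0.
Proof.
have v_gt1 : (1 < pds_mod q)%N by rewrite /pds_mod addn1 ltnS addn_gt0 q_gt0 orbT.
have v0 : 1 + q%:R + q%:R ^+ 2 = 0 :> pds_point q.
  have -> : 1 + q%:R + q%:R ^+ 2 = (pds_mod q)%:R :> pds_point q.
    by rewrite /pds_mod !natrD natrX; ring.
  by apply: val_inj; rewrite /= val_Zp_nat // modnn.
rewrite /choice_mult; case: ifP => // _.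
by rewrite -[RHS](mulr0 (1 - q%:R + q%:R ^+ 2)) -v0; ring.
Qed.

(** With [e = b - a] and multiplier [m], the next difference is [c - b = m e]. It lies in the same
    orbit, so it has the same multiplier, and [c + m^2 e = a + (1 + m + m^2) e = a]. *)
Lemma choice_triples_rot A (a b c : pds_point q) :
  (a, b, c) \in choice_triples A -> (b, c, a) \in choice_triples A.
Proof.
move=> /choice_triplesP[Dba cE]; apply/choice_triplesP.
have cbE : c - b = choice_mult A (b - a) * (b - a) by rewrite cE addrC addKr.
rewrite cbE choice_multK; split; first exact: mem_choice_mult.
rewrite cE; set e := b - a; rewrite -/e in cE *.
rewrite -[LHS](addr0) -(mul0r e) -(choice_mult_sum0 A e).
by rewrite (_ : b = a + e) /e; ring.
Qed.

Lemma choice_triples_presentation A : (1 < q)%N -> perfect_difference_set D ->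
  triangle_presentation (@pds_inc q D) (pds_alpha D) (choice_triples A).
Proof.
move=> q_gt1 pdsD; split.
- exact: pds_plane.
- exact: pds_alpha_bij.
- move=> a b; rewrite /pds_inc /= mem_translate; split.
    by case=> c /choice_triplesP[].
  by move=> Dba; exists (b + choice_mult A (b - a) * (b - a)); apply/choice_triplesP.
- exact: choice_triples_rot.
- by move=> a b c c' /choice_triplesP[_ ->] /choice_triplesP[_ ->].
Qed.

(** Only orbits of size 3 may vary: on a fixed point [q e = q^2 e], so the choice there leaves no
    trace. *)
Lemma choice_triples_inj :
  {in powerset [set O in mulq_orbits D | #|O| == 3] &, injective choice_triples}.
Proof.
move=> A B; rewrite !inE => /subsetP sA /subsetP sB eqAB; apply/setP=> O.
have [|nO] := boolP (O \in [set O in mulq_orbits D | #|O| == 3]); last first.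
  by rewrite (contraNF (sA O) nO) (contraNF (sB O) nO).
rewrite inE => /andP[/imsetP[e De ->]]; rewrite card_orbit_mulq // -/(mulq_orbit e).
case: (mulq e =P e) => // ne _.
(* The triple starting with [0, e] reveals the multiplier of [e]. *)
have : (0, e, e + choice_mult A e * e) \in choice_triples B.
  by rewrite -eqAB; apply/choice_triplesP; rewrite subr0.
case/choice_triplesP; rewrite subr0 => _ /addrI.
have ne2 : q%:R * e <> q%:R ^+ 2 * e.
  by rewrite expr2 -mulrA => /(mulq_inj q_gt0)/esym/ne.
by rewrite /choice_mult; case: ifP => _; case: ifP => _ // /esym.
Qed.

(** If [d] represents the orbit of [e] and [m] is its multiplier, then [e] is [d], [m d] or [m^2 d];
    accordingly a triple with difference [e] is a bracket triple, its rotation or its double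
    rotation. *)
Lemma choice_triples_closure n (d' : 'I_n -> pds_point q) A :
  is_transversal [set d' i | i in setT] (mulq_orbits D) D ->
  choice_triples A =
  cyclic_closure (\bigcup_i bracket (d' i) (choice_mult A (d' i))).
Proof.
case/and3P=> _ /subsetP sD' /forall_inP trD'.
apply/eqP; rewrite eqEsubset; apply/andP; split; apply/subsetP.
- move=> [[a b] c] /choice_triplesP[De cE].
  set e := b - a in De cE; have bE : b = a + e by rewrite /e; ring.
  clearbody e.
  have /trD'/cards1P[x /setP/(_ x)] : mulq_orbit e \in mulq_orbits D.
    exact: imset_f.
  rewrite !inE eqxx -fconnect_orbit => /andP[/imsetP[i _ ->]].
  set d := d' i => ed.
  have orb_de : mulq_orbit d = mulq_orbit e.
    apply/setP=> y; rewrite !inE -!fconnect_orbit.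
    by rewrite (same_connect (fconnect_sym (mulq_inj q_gt0)) ed).
  have mE : choice_mult A e = choice_mult A d by rewrite /choice_mult orb_de.
  rewrite mE in cE; set m := choice_mult A d in cE.
  have m0 : 1 + m + m ^+ 2 = 0 := choice_mult_sum0 A d.
  have inU j : (j, j + d, j + d + m * d) \in
      \bigcup_i0 bracket (d' i0) (choice_mult A (d' i0)).
    by apply/bigcupP; exists i => //; apply/imsetP; exists j.
  have m3 : m ^+ 3 = 1.
    by apply/eqP; rewrite -subr_eq0 -[X in _ == X](mulr0 (m - 1)) -m0; apply/eqP; ring.
  have : [\/ e = d, e = m * d | e = m ^+ 2 * d].
    have := mem_mulq_orbit e; rewrite -orb_de /mulq_orbit orbit_mulqE // !inE.
    (* When [m = q^2], [m^2 d = q^4 d = q d], so [m d] and [m^2 d] trade places. *)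
    have q4 : mulq d = q%:R ^+ 2 ^+ 2 * d.
      by rewrite -{1}(mulq3 q_gt0 d) /mulq; ring.
    rewrite -orbA /m /choice_mult; case: ifP => _ /or3P[] /eqP ->.
    - by constructor 1.
    - by constructor 3.
    - by constructor 2; rewrite /mulq; ring.
    - by constructor 1.
    - by constructor 2.
    - by constructor 3; rewrite /mulq; ring.
  rewrite cE bE => -[] ->.
  + by rewrite inU.
  + apply/orP; left; apply/orP; right; apply/imsetP.
    (* Rotating [(a - d, a, a + m d)] gives [(a, a + m d, a - d)], and [-d = m d + m^2 d]. *)
    exists (a - d, a - d + d, a - d + d + m * d); first exact: inU.
    rewrite /= (_ : a - d + d = a); last by ring.
    congr (_, _, _); rewrite -[RHS]addr0 -(mul0r d) -m0; ring.
  (* The bracket triple at [j = a + m^2 d] ends in [a]; rotated twice it is [(a, j, j + d)], where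
     [d = m^3 d]. *)
  + apply/orP; right; apply/imsetP; pose j := a + m ^+ 2 * d.
    exists (j, j + d, j + d + m * d); first exact: inU.
    have aE : j + d + m * d = a.
      by rewrite -[RHS]addr0 -(mul0r d) -m0 /j; ring.
    rewrite /= aE; congr (_, _, _).
    by rewrite -/j mulrA -exprS m3 mul1r.
(* Conversely, [choice_triples A] contains the brackets and is stable under rotation. *)
have sub x : x \in \bigcup_i bracket (d' i) (choice_mult A (d' i)) ->
    x \in choice_triples A.
  case/bigcupP=> i _ /imsetP[j _ ->]; apply/choice_triplesP.
  rewrite (_ : j + d' i - j = d' i); last by ring.
  by split=> //; apply: sD'; apply: imset_f.
have rot x : x \in choice_triples A -> rot3 x \in choice_triples A.
  by case: x => -[a b] c; apply: choice_triples_rot.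
move=> x; rewrite /cyclic_closure !in_setU -orbA => /or3P[|/imsetP[y]|/imsetP[y]].
- exact: sub.
- by move/sub => yT ->; apply: rot.
- by move/sub => yT ->; exact: rot (rot _ yT).
Qed.

End Choices.

Theorem corollary2p6 (q : nat) (D : {set pds_point q})
    (d' : 'I_(nb_fixed D + nb_orbits3 D) -> pds_point q) :
  prime_power q ->
  perfect_difference_set D ->
  mulq_stable D ->
  is_transversal [set d' i | i in setT] (mulq_orbits D) D ->
  exists S : {set {set pds_point q * pds_point q * pds_point q}},
    (2 ^ nb_orbits3 D <= #|S|)%N /\
    forall T, T \in S ->
      triangle_presentation (@pds_inc q D) (pds_alpha D) T /\
      exists m : 'I_(nb_fixed D + nb_orbits3 D) -> pds_point q,
        (forall i, m i = q%:R \/ m i = q%:R ^+ 2) /\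
        T = cyclic_closure (\bigcup_i bracket (d' i) (m i)).
Proof.
move=> /prime_power_gt1 q_gt1 pdsD qD trD'; have q_gt0 := ltnW q_gt1.
(* One presentation for each set of orbits of size 3; fixed points always receive [q]. *)
exists [set choice_triples D A |
         A in powerset [set O in mulq_orbits D | #|O| == 3]]; split.
  by rewrite card_in_imset ?card_powerset //; apply: choice_triples_inj.
move=> _ /imsetP[A _ ->]; split; first exact: choice_triples_presentation.
exists (fun i => choice_mult A (d' i)); split; last exact: choice_triples_closure.
by move=> i; rewrite /choice_mult; case: ifP; [right|left].
Qed.
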